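(* Let $(X,S)$ be a nondegenerate braided set. The map $\psi_M:X\to M_X$, $x\mapsto v_x$, is injective if and only if $(X,S)$ is an injective solution.
   Context: Let $X$ be a nonempty set and $S:X\times X\to X\times X$ a bijection, written $S(x,y)=(g_x(y),f_y(x))$. $(X,S)$ is a braided set if $S_1S_2S_1=S_2S_1S_2$ on $X^3$, where $S_1=S\times \mathrm{id}$, $S_2=\mathrm{id}\times S$; it is nondegenerate if all maps $g_x$ and $f_y$ are bijections of $X$. Write $x\circ y=g_x(y)$, $y*x=f_y^{-1}(x)$, $y^{-1}*x=f_y(x)$, and $\phi(y,x)=x^{-1}*((y*x)\circ y)$. The structure group $G_X$ is the group generated by the elements of $X$ with relations $xy=y_1x_1$ whenever $S(x,y)=(y_1,x_1)$; $\psi_G:X\to G_X$ is the natural map. A nondegenerate braided set is called an injective solution if $\psi_G$ is injective. The derived structure group $A_X$ is the group generated by the elements of $X$ with relations $\phi(y,x)\bullet x=x\bullet y$ for $x,y\in X$; $\psi_A:X\to A_X$ is the natural map. The group $A_X$ acts on $X$ with $\psi_A(x)$ acting by $y\mapsto\phi(y,x)$; $A_X^0\subset \mathrm{Permut}(X)$ is the image of $A_X$ under this action and $p:A_X\to A_X^0$ the resulting surjection; write $p(x)$ for $p(\psi_A(x))$. $M_X$ is the left $A_X^0$-module (i.e. $\mathbb{Z}[A_X^0]$-module) generated by symbols $v_x$, $x\in X$, subject to the relations $p(y)^{-1}v_x+v_y=p(x)^{-1}v_{\phi(y,x)}+v_x$ for $x,y\in X$. *)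

(* Defs.v *)
From HB Require Import structures.
From mathcomp Require Import all_boot all_order all_algebra.
From mathcomp Require ring_quotient.
From mathcomp Require Import finmap monalg.
From mathcomp Require Import boolp.

Set Implicit Arguments.
Unset Strict Implicit.
Unset Printing Implicit Defensive.

Import GRing.Theory.

Local Open Scope quotient_scope.
Local Open Scope group_scope.
Local Open Scope ring_scope.

Section BijInv.
Variables (T U : Type) (f : T -> U).

Lemma bij_inv_ex : bijective f -> exists g, cancel f g /\ cancel g f.
Proof. by case=> g fK gK; exists g. Qed.

Definition bij_inv (bf : bijective f) : U -> T := projT1 (cid (bij_inv_ex bf)).

Lemma bij_invK (bf : bijective f) : cancel f (bij_inv bf).
Proof. by rewrite /bij_inv; case: cid => g []. Qed.

Lemma bij_invVK (bf : bijective f) : cancel (bij_inv bf) f.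
Proof. by rewrite /bij_inv; case: cid => g []. Qed.

Lemma bij_inv_bij (bf : bijective f) : bijective (bij_inv bf).
Proof. by exists f; [exact: bij_invVK|exact: bij_invK]. Qed.

End BijInv.

(* The group of all bijections of T, acting on the left:
   (s * t) x = s (t x), unlike {perm T}. *)
Section Permut.
Variable T : Type.

Record permut := Permut { permut_fun :> T -> T;
                          permut_bij : bijective permut_fun }.

Lemma permutP (s t : permut) : s =1 t -> s = t.
Proof.
case: s t => [s bs] [t bt] /= /funext st.
by subst t; congr Permut; exact: Prop_irrelevance.
Qed.

HB.instance Definition _ := gen_eqMixin permut.
HB.instance Definition _ := gen_choiceMixin permut.

Definition permut_one := Permut (inv_bij (fun=> erefl) : bijective (@id T)).
Definition permut_inv (s : permut) := Permut (bij_inv_bij (permut_bij s)).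
Definition permut_mul (s t : permut) :=
  Permut (bij_comp (permut_bij s) (permut_bij t)).

Lemma permut_mulA : associative permut_mul.
Proof. by move=> s t u; apply: permutP. Qed.
Lemma permut_1mul : left_id permut_one permut_mul.
Proof. by move=> s; apply: permutP. Qed.
Lemma permut_mul1 : right_id permut_one permut_mul.
Proof. by move=> s; apply: permutP. Qed.
Lemma permut_Vmul : left_inverse permut_one permut_inv permut_mul.
Proof. by move=> s; apply: permutP => x; exact: bij_invK. Qed.
Lemma permut_mulV : right_inverse permut_one permut_inv permut_mul.
Proof. by move=> s; apply: permutP => x; exact: bij_invVK. Qed.

HB.instance Definition _ := isGroup.Build permut
  permut_mulA permut_1mul permut_mul1 permut_Vmul permut_mulV.

End Permut.

Section GroupPresentation.
Variable I : Type.

Inductive gterm :=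
  | GGen of I
  | GOne
  | GMul of gterm & gterm
  | GInv of gterm.

HB.instance Definition _ := gen_eqMixin gterm.
HB.instance Definition _ := gen_choiceMixin gterm.

Variable r : gterm -> gterm -> Prop.

(* The least congruence containing r whose quotient is a group. *)
Inductive gpres_eq : gterm -> gterm -> Prop :=
  | GP_rel u v : r u v -> gpres_eq u v
  | GP_refl u : gpres_eq u u
  | GP_sym u v : gpres_eq u v -> gpres_eq v u
  | GP_trans v u w : gpres_eq u v -> gpres_eq v w -> gpres_eq u w
  | GP_mul u u' v v' :
      gpres_eq u u' -> gpres_eq v v' -> gpres_eq (GMul u v) (GMul u' v')
  | GP_inv u u' : gpres_eq u u' -> gpres_eq (GInv u) (GInv u')
  | GP_mulA u v w : gpres_eq (GMul u (GMul v w)) (GMul (GMul u v) w)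
  | GP_1mul u : gpres_eq (GMul GOne u) u
  | GP_mul1 u : gpres_eq (GMul u GOne) u
  | GP_Vmul u : gpres_eq (GMul (GInv u) u) GOne
  | GP_mulV u : gpres_eq (GMul u (GInv u)) GOne.

Definition gpres_eqb : rel gterm := fun u v => `[< gpres_eq u v >].

Lemma gpres_eqb_refl : reflexive gpres_eqb.
Proof. by move=> u; apply/asboolP; exact: GP_refl. Qed.
Lemma gpres_eqb_sym : symmetric gpres_eqb.
Proof. by move=> u v; apply/asboolP/asboolP; exact: GP_sym. Qed.
Lemma gpres_eqb_trans : transitive gpres_eqb.
Proof.
by move=> v u w /asboolP uv /asboolP vw; apply/asboolP; exact: GP_trans uv vw.
Qed.

Canonical gpres_equiv :=
  EquivRel gpres_eqb gpres_eqb_refl gpres_eqb_sym gpres_eqb_trans.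

Definition gpres := {eq_quot gpres_eqb}.

HB.instance Definition _ := EqQuotient.on gpres.
HB.instance Definition _ := Choice.on gpres.

Definition gpres_pi (u : gterm) : gpres := \pi_gpres u.
Definition gpres_gen (i : I) : gpres := gpres_pi (GGen i).

Lemma gpres_piP u v : gpres_pi u = gpres_pi v <-> gpres_eq u v.
Proof.
by split=> [/eqmodP/asboolP|uv] //; apply/eqmodP/asboolP.
Qed.

Lemma gpres_reprP u : gpres_eq (repr (gpres_pi u)) u.
Proof. by apply/gpres_piP; rewrite /gpres_pi reprK. Qed.

Definition gpres_one : gpres := gpres_pi GOne.
(* Here and below, locked only prevents unification from unfolding. *)
Definition gpres_mul : gpres -> gpres -> gpres :=
  locked (fun a b => gpres_pi (GMul (repr a) (repr b))).
Definition gpres_inv : gpres -> gpres :=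
  locked (fun a => gpres_pi (GInv (repr a))).

Lemma gpres_piM u v : gpres_pi (GMul u v) = gpres_mul (gpres_pi u) (gpres_pi v).
Proof.
rewrite /gpres_mul -lock; apply/gpres_piP.
by apply: GP_mul; apply: GP_sym; exact: gpres_reprP.
Qed.
Lemma gpres_piV u : gpres_pi (GInv u) = gpres_inv (gpres_pi u).
Proof.
rewrite /gpres_inv -lock; apply/gpres_piP.
by apply: GP_inv; apply: GP_sym; exact: gpres_reprP.
Qed.

Lemma gpres_ind (P : gpres -> Prop) :
  (forall u, P (gpres_pi u)) -> forall a, P a.
Proof. by move=> Pu a; rewrite -[a]reprK; exact: Pu. Qed.

Lemma gpres_mulA : associative gpres_mul.
Proof.
elim/gpres_ind=> u; elim/gpres_ind=> v; elim/gpres_ind=> w.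
by rewrite -!gpres_piM; apply/gpres_piP; exact: GP_mulA.
Qed.
Lemma gpres_1mul : left_id gpres_one gpres_mul.
Proof.
by elim/gpres_ind=> u; rewrite -gpres_piM; apply/gpres_piP; exact: GP_1mul.
Qed.
Lemma gpres_mul1 : right_id gpres_one gpres_mul.
Proof.
by elim/gpres_ind=> u; rewrite -gpres_piM; apply/gpres_piP; exact: GP_mul1.
Qed.
Lemma gpres_Vmul : left_inverse gpres_one gpres_inv gpres_mul.
Proof.
elim/gpres_ind=> u; rewrite -gpres_piV -gpres_piM.
by apply/gpres_piP; exact: GP_Vmul.
Qed.
Lemma gpres_mulV : right_inverse gpres_one gpres_inv gpres_mul.
Proof.
elim/gpres_ind=> u; rewrite -gpres_piV -gpres_piM.
by apply/gpres_piP; exact: GP_mulV.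
Qed.

HB.instance Definition _ := isGroup.Build gpres
  gpres_mulA gpres_1mul gpres_mul1 gpres_Vmul gpres_mulV.

Section Lift.
Variables (H : groupType) (h : I -> H).

Fixpoint geval (u : gterm) : H :=
  match u with
  | GGen i => h i
  | GOne => 1%g
  | GMul u v => (geval u * geval v)%g
  | GInv u => ((geval u)^-1)%g
  end.

Definition gpres_lift (a : gpres) : H := geval (repr a).

Hypothesis hr : forall u v, r u v -> geval u = geval v.

Lemma geval_eq u v : gpres_eq u v -> geval u = geval v.
Proof.
elim=> //= {u v}; first (by move=> ? ? ? _ -> _ ->);
  first (by move=> ? ? ? ? _ -> _ ->); first (by move=> ? ? _ ->).
- by move=> ? ? ?; rewrite mulgA.
- by move=> ?; rewrite mul1g.
- by move=> ?; rewrite mulg1.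
- by move=> ?; rewrite mulVg.
- by move=> ?; rewrite mulgV.
Qed.

Lemma gpres_lift_pi u : gpres_lift (gpres_pi u) = geval u.
Proof. by apply: geval_eq; exact: gpres_reprP. Qed.

Lemma gpres_lift_gen i : gpres_lift (gpres_gen i) = h i.
Proof. exact: gpres_lift_pi. Qed.

Lemma gpres_liftM : {morph gpres_lift : a b / (a * b)%g}.
Proof.
elim/gpres_ind=> u; elim/gpres_ind=> v.
have -> : (gpres_pi u * gpres_pi v)%g = gpres_pi (GMul u v).
  by rewrite gpres_piM.
by rewrite !gpres_lift_pi.
Qed.

Lemma gpres_lift1 : gpres_lift 1%g = 1%g.
Proof. exact: (gpres_lift_pi GOne). Qed.

Lemma gpres_liftV : {morph gpres_lift : a / (a^-1)%g}.
Proof.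
elim/gpres_ind=> u.
have -> : ((gpres_pi u)^-1)%g = gpres_pi (GInv u) by rewrite gpres_piV.
by rewrite !gpres_lift_pi.
Qed.

End Lift.
End GroupPresentation.

(* The integral group ring Z[G] of a possibly infinite group: {malg int[G]} is
   only a zmodType here, as its ring structure in monalg requires a monomType,
   whose only unit is 1. *)
Definition group_ring (G : groupType) : Type := {malg int[G]}.

Section GroupRing.
Variable G : groupType.
Implicit Types a b c : {malg int[G]}.

HB.instance Definition _ := GRing.Zmodule.on (group_ring G).

Definition gr_mul : {malg int[G]} -> {malg int[G]} -> {malg int[G]} :=
  locked (fun a b =>
    \sum_(s <- msupp a) \sum_(t <- msupp b) << a@_s * b@_t *g (s * t)%g >>).

Lemma gr_mulE a b : gr_mul a b =
  \sum_(s <- msupp a) \sum_(t <- msupp b) << a@_s * b@_t *g (s * t)%g >>.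
Proof. by rewrite /gr_mul -lock. Qed.

Local Open Scope fset_scope.

Lemma gr_mulw (d1 d2 : {fset G}) a b : msupp a `<=` d1 -> msupp b `<=` d2 ->
  gr_mul a b = \sum_(s <- d1) \sum_(t <- d2) << a@_s * b@_t *g (s * t)%g >>.
Proof.
move=> le1 le2; rewrite gr_mulE (big_fset_incl _ le1) /=.
  apply/eq_bigr=> s _; apply/big_fset_incl => // t _ /mcoeff_outdom ->.
  by rewrite mulr0 monalgU0.
move=> s _ /mcoeff_outdom as0.
by rewrite big1 => // t _; rewrite as0 mul0r monalgU0.
Qed.

Lemma gr_mul0r : left_zero 0 gr_mul.
Proof. by move=> a; rewrite gr_mulE msupp0 big_seq_fset0. Qed.

Lemma gr_mulr0 : right_zero 0 gr_mul.
Proof.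
by move=> a; rewrite gr_mulE big1 // => s _; rewrite msupp0 big_seq_fset0.
Qed.

Lemma gr_mulDl : left_distributive gr_mul +%R.
Proof.
move=> a b c; set d := msupp a `|` msupp b.
rewrite (@gr_mulw d (msupp c) (a + b)) ?fsubset_refl ?msuppD_le //.
rewrite (@gr_mulw d (msupp c) a) ?fsubset_refl ?fsubsetUl //.
rewrite (@gr_mulw d (msupp c) b) ?fsubset_refl ?fsubsetUr //.
rewrite -big_split /=; apply/eq_bigr=> s _.
rewrite -big_split /=; apply/eq_bigr=> t _.
by rewrite mcoeffD mulrDl monalgUD.
Qed.

Lemma gr_mulDr : right_distributive gr_mul +%R.
Proof.
move=> a b c; set d := msupp b `|` msupp c.
rewrite (@gr_mulw (msupp a) d a (b + c)) ?fsubset_refl ?msuppD_le //.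
rewrite (@gr_mulw (msupp a) d a b) ?fsubset_refl ?fsubsetUl //.
rewrite (@gr_mulw (msupp a) d a c) ?fsubset_refl ?fsubsetUr //.
rewrite -big_split /=; apply/eq_bigr=> s _.
rewrite -big_split /=; apply/eq_bigr=> t _.
by rewrite mcoeffD mulrDr monalgUD.
Qed.

Lemma gr_mulUU (m n : int) (s t : G) :
  gr_mul << m *g s >> << n *g t >> = << m * n *g (s * t)%g >>.
Proof. by rewrite (gr_mulw msuppU_le msuppU_le) !big_seq_fset1 !mcoeffUU. Qed.

Lemma gr_mul_suml (K : Type) (l : seq K) (F : K -> {malg int[G]}) b :
  gr_mul (\sum_(k <- l) F k) b = \sum_(k <- l) gr_mul (F k) b.
Proof.
exact: (big_morph (gr_mul^~ b) (fun x y => gr_mulDl x y b) (gr_mul0r b)).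
Qed.

Lemma gr_mul_sumr (K : Type) (l : seq K) (F : K -> {malg int[G]}) a :
  gr_mul a (\sum_(k <- l) F k) = \sum_(k <- l) gr_mul a (F k).
Proof. exact: (big_morph (gr_mul a) (gr_mulDr a) (gr_mulr0 a)). Qed.

Lemma gr_mulA : associative gr_mul.
Proof.
move=> a b c; rewrite (monalgE a) !gr_mul_suml; apply/eq_bigr=> s _.
rewrite (monalgE b) gr_mul_suml !gr_mul_sumr gr_mul_suml; apply/eq_bigr=> t _.
rewrite (monalgE c) !gr_mul_sumr; apply/eq_bigr=> w _.
by rewrite !gr_mulUU mulrA mulgA.
Qed.

Definition gr_of : G -> group_ring G := locked (fun s => << s >>).

Lemma gr_ofE s : gr_of s = << s >>.
Proof. by rewrite /gr_of -lock. Qed.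

Lemma gr_mul1r : left_id (gr_of 1%g) gr_mul.
Proof.
move=> a; rewrite gr_ofE [in LHS](monalgE a) gr_mul_sumr [RHS]monalgE.
by apply/eq_bigr=> s _; rewrite gr_mulUU mul1r mul1g.
Qed.

Lemma gr_mulr1 : right_id (gr_of 1%g) gr_mul.
Proof.
move=> a; rewrite gr_ofE [in LHS](monalgE a) gr_mul_suml [RHS]monalgE.
by apply/eq_bigr=> s _; rewrite gr_mulUU mulr1 mulg1.
Qed.

Lemma gr_oner_neq0 : (gr_of 1%g) != 0 :> {malg int[G]}.
Proof. by rewrite gr_ofE monalgU_eq0. Qed.

HB.instance Definition _ := GRing.Zmodule_isNzRing.Build (group_ring G)
  gr_mulA gr_mul1r gr_mulr1 gr_mulDl gr_mulDr gr_oner_neq0.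

Lemma gr_ofM (s t : G) : gr_of (s * t)%g = gr_of s * gr_of t.
Proof. by rewrite !gr_ofE [RHS]gr_mulUU mulr1. Qed.

End GroupRing.

Section LmodQuotient.
Variables (R : nzRingType) (V : lmodType R) (rels : V -> Prop).

(* The submodule of V generated by the elements satisfying rels. *)
Definition span_rels : {pred V} := fun v =>
  `[< forall N : {pred V}, GRing.submod_closed N ->
        (forall w, rels w -> w \in N) -> v \in N >].

Lemma span_relsP v : v \in span_rels <->
  (forall N : {pred V}, GRing.submod_closed N ->
     (forall w, rels w -> w \in N) -> v \in N).
Proof. by split=> [/asboolP|?] //; apply/asboolP. Qed.

Lemma span_rels_submod : GRing.submod_closed span_rels.
Proof.
split=> [|a u v /span_relsP uN /span_relsP vN]; apply/span_relsP=> N cN rN.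
  by case: cN.
by case: (cN) => _ NZ; apply: NZ; [exact: uN|exact: vN].
Qed.

HB.instance Definition _ :=
  GRing.isSubmodClosed.Build R V span_rels span_rels_submod.

Definition lmod_pres : Type := ring_quotient.Quotient.quot span_rels.

HB.instance Definition _ := GRing.Zmodule.on lmod_pres.
HB.instance Definition _ := Quotient.on lmod_pres.

Definition lmod_pi (v : V) : lmod_pres :=
  \pi_(ring_quotient.Quotient.quot span_rels) v.
Definition lmod_repr (m : lmod_pres) : V :=
  repr (m : ring_quotient.Quotient.quot span_rels).

Lemma lmod_piP u v : lmod_pi u = lmod_pi v <-> u - v \in span_rels.
Proof.
by rewrite (ring_quotient.Quotient.idealrBE span_rels); split=> [?|/eqP//];
   apply/eqP.
Qed.

Lemma lmod_reprK m : lmod_pi (lmod_repr m) = m.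
Proof. exact: reprK. Qed.

Lemma lmod_piD u v : lmod_pi (u + v) = lmod_pi u + lmod_pi v.
Proof. exact: ring_quotient.Quotient.pi_add. Qed.

Lemma lmod_ind (P : lmod_pres -> Prop) :
  (forall v, P (lmod_pi v)) -> forall m, P m.
Proof. by move=> Pv m; rewrite -[m]lmod_reprK; exact: Pv. Qed.

Definition lmod_scale (a : R) : lmod_pres -> lmod_pres :=
  locked (fun m => lmod_pi (a *: lmod_repr m)).

Lemma lmod_piZ a v : lmod_pi (a *: v) = lmod_scale a (lmod_pi v).
Proof.
rewrite /lmod_scale -lock; apply/lmod_piP; rewrite -scalerBr; apply: rpredZ.
by apply/lmod_piP; rewrite lmod_reprK.
Qed.

Lemma lmod_scaleA a b m : lmod_scale a (lmod_scale b m) = lmod_scale (a * b) m.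
Proof. by elim/lmod_ind: m => v; rewrite -!lmod_piZ scalerA. Qed.
Lemma lmod_scale1 : left_id 1 lmod_scale.
Proof. by elim/lmod_ind=> v; rewrite -lmod_piZ scale1r. Qed.
Lemma lmod_scaleDr : right_distributive lmod_scale +%R.
Proof.
move=> a; elim/lmod_ind=> u; elim/lmod_ind=> v.
by rewrite -lmod_piD -!lmod_piZ scalerDr lmod_piD.
Qed.
Lemma lmod_scaleDl m : {morph lmod_scale^~ m : a b / a + b}.
Proof.
by move=> a b; elim/lmod_ind: m => v; rewrite -!lmod_piZ scalerDl lmod_piD.
Qed.

HB.instance Definition _ := GRing.Zmodule_isLmodule.Build R lmod_pres
  lmod_scaleA lmod_scale1 lmod_scaleDr lmod_scaleDl.

Lemma lmod_pi_is_linear : linear lmod_pi.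
Proof. by move=> a u v; rewrite lmod_piD lmod_piZ. Qed.

HB.instance Definition _ :=
  GRing.isLinear.Build R V lmod_pres *:%R lmod_pi lmod_pi_is_linear.

Lemma lmod_pi_rel a b u v u' v' :
  rels ((a *: u + v) - (b *: u' + v')) ->
  a *: lmod_pi u + lmod_pi v = b *: lmod_pi u' + lmod_pi v'.
Proof.
move=> rel_uv; rewrite -!linearP.
by apply/lmod_piP/span_relsP => N _; apply.
Qed.

End LmodQuotient.

Section Braid.
Variables (T : Type) (S : T * T -> T * T).

Definition S1 (t : T * T * T) : T * T * T :=
  let: (x, y, z) := t in let: (u, v) := S (x, y) in (u, v, z).
Definition S2 (t : T * T * T) : T * T * T :=
  let: (x, y, z) := t in let: (u, v) := S (y, z) in (x, u, v).

Definition braid_relation := forall t, S1 (S2 (S1 t)) = S2 (S1 (S2 t)).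

(* S (x, y) = (g_x y, f_y x), see SE. *)
Definition g_ (x y : T) : T := (S (x, y)).1.
Definition f_ (y x : T) : T := (S (x, y)).2.

Definition nondegenerate :=
  (forall x, bijective (g_ x)) /\ (forall y, bijective (f_ y)).

Lemma SE x y : S (x, y) = (g_ x y, f_ y x).
Proof. by rewrite /g_ /f_; case: (S (x, y)). Qed.

End Braid.

Record nd_braided_set := NdBraidedSet {
  carrier :> Type;
  carrier_nonempty : inhabited carrier;
  braiding : carrier * carrier -> carrier * carrier;
  braiding_bij : bijective braiding;
  braidingP : braid_relation braiding;
  braiding_nondegenerate : nondegenerate braiding
}.

HB.instance Definition _ (X : nd_braided_set) := gen_eqMixin (carrier X).
HB.instance Definition _ (X : nd_braided_set) := gen_choiceMixin (carrier X).

Section Derived.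
Variables (T : Type) (S : T * T -> T * T).
Hypothesis SP : braid_relation S.
Local Notation g := (g_ S).
Local Notation f := (f_ S).

Lemma braid_f z y a : f z (f y a) = f (f z y) (f (g y z) a).
Proof. by move: (SP (a, y, z)); rewrite /S1 /S2 !SE => -[]. Qed.

Lemma braid_gf a y z : f (g (f y a) z) (g a y) = g (f (g y z) a) (f z y).
Proof. by move: (SP (a, y, z)); rewrite /S1 /S2 !SE => -[]. Qed.

(* This is phi y (f y a), see phi_f below.  It is defined without inverting f,
   so that f_phi_aux also applies to the inverse of the braiding. *)
Definition phi_aux (y a : T) := f (f y a) (g a y).

Lemma f_phi_aux z y a :
  f z (phi_aux y a) = phi_aux (f z y) (f (g y z) a).
Proof. by rewrite /phi_aux braid_f braid_gf -braid_f. Qed.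

End Derived.

Section StructureGroup.
Variable X : nd_braided_set.
Local Notation S := (@braiding X).

Inductive G_rel : gterm X -> gterm X -> Prop :=
  | G_Rel x y y1 x1 : S (x, y) = (y1, x1) ->
      G_rel (GMul (GGen x) (GGen y)) (GMul (GGen y1) (GGen x1)).

Definition G_ := gpres G_rel.
HB.instance Definition _ := Group.on G_.

Definition psi_G (x : X) : G_ := gpres_gen G_rel x.

Definition injective_solution := injective psi_G.

End StructureGroup.

Section DerivedOperation.
Variable X : nd_braided_set.
Local Notation S := (@braiding X).

Lemma f_bij y : bijective (f_ S y).
Proof. exact: (braiding_nondegenerate X).2. Qed.

(* circ x y = x o y, star y x = y * x, starV y x = y^-1 * x. *)
Definition circ (x y : X) : X := g_ S x y.
Definition star (y x : X) : X := bij_inv (f_bij y) x.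
Definition starV (y x : X) : X := f_ S y x.
Definition phi (y x : X) : X := starV x (circ (star y x) y).

Lemma phi_f y a : phi y (f_ S y a) = phi_aux S y a.
Proof. by rewrite /phi /phi_aux /star bij_invK. Qed.

Lemma f_phi z y x : f_ S z (phi y x) = phi (f_ S z y) (f_ S z x).
Proof.
rewrite -[x](bij_invVK (f_bij y)); set a := bij_inv _ _.
by rewrite phi_f (f_phi_aux (@braidingP X)) (braid_f (@braidingP X)) phi_f.
Qed.

Definition braiding_inv := bij_inv (@braiding_bij X).
Local Notation S' := braiding_inv.

Lemma braidingK : cancel S S'. Proof. exact: bij_invK. Qed.
Lemma braiding_invK : cancel S' S. Proof. exact: bij_invVK. Qed.

Definition tau x y : X := circ (star y x) y.

Lemma braiding_tau x y : S (star y x, y) = (tau x y, x).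
Proof. by rewrite SE /tau /circ bij_invVK. Qed.

Lemma tauK x : cancel (tau x) (f_ S' x).
Proof. by move=> y; rewrite /f_ -braiding_tau braidingK. Qed.

Lemma tauVK x : cancel (f_ S' x) (tau x).
Proof.
move=> b; have := braiding_invK (b, x); rewrite (SE S' b x) (SE S) => -[gb fx].
by rewrite /tau /circ /star -[X in bij_inv _ X]fx bij_invK.
Qed.

Lemma braid_inv : braid_relation S'.
Proof.
have K1 : cancel (S1 S') (S1 S).
  by case=> -[x y] z /=; case E: (S' _) => [u v] /=; rewrite -E braiding_invK.
have K1' : cancel (S1 S) (S1 S').
  by case=> -[x y] z /=; case E: (S _) => [u v] /=; rewrite -E braidingK.
have K2 : cancel (S2 S') (S2 S).
  by case=> -[x y] z /=; case E: (S' _) => [u v] /=; rewrite -E braiding_invK.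
have K2' : cancel (S2 S) (S2 S').
  by case=> -[x y] z /=; case E: (S _) => [u v] /=; rewrite -E braidingK.
move=> t; apply: (can_inj K1'); apply: (can_inj K2'); apply: (can_inj K1').
by rewrite [RHS](@braidingP X) !(K1, K2).
Qed.

Definition phi_inv y x : X := f_ S' x (bij_inv (f_bij x) y).

Lemma phiK x : cancel (phi^~ x) (phi_inv^~ x).
Proof. by move=> y; rewrite /phi_inv /phi /starV bij_invK tauK. Qed.

Lemma phiVK x : cancel (phi_inv^~ x) (phi^~ x).
Proof. by move=> y; rewrite /phi -/(tau _ _) tauVK /starV bij_invVK. Qed.

Lemma phi_bij x : bijective (phi^~ x).
Proof. by exists (phi_inv^~ x); [exact: phiK|exact: phiVK]. Qed.

Lemma phi_inv_f y a : phi_aux S' y a = phi_inv y (f_ S' y a).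
Proof.
have := braiding_invK (a, y); rewrite (SE S' a y) (SE S) => -[_ fx].
rewrite /phi_aux /phi_inv; congr (f_ _ _ _).
by rewrite -[X in bij_inv _ X]fx bij_invK.
Qed.

Lemma f'_phi_inv z y x : f_ S' z (phi_inv y x) = phi_inv (f_ S' z y) (f_ S' z x).
Proof.
rewrite -[x](tauK y); set a := tau y x.
by rewrite -phi_inv_f (f_phi_aux braid_inv) (braid_f braid_inv) phi_inv_f.
Qed.

Lemma f'_phi z y x : f_ S' z (phi y x) = phi (f_ S' z y) (f_ S' z x).
Proof.
by rewrite -[X in phi (f_ S' z X)](phiK x) f'_phi_inv (phiVK (f_ S' z x)).
Qed.

Lemma tau_phi z y x : tau z (phi y x) = phi (tau z y) (tau z x).
Proof. by apply: (can_inj (@tauVK z)); rewrite f'_phi !tauK. Qed.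

Lemma phi_phi z y x : phi (phi z y) x = phi (phi z x) (phi y x).
Proof.
by rewrite {1}/phi /starV -/(tau x _) tau_phi f_phi.
Qed.

End DerivedOperation.

Section DerivedStructureGroup.
Variable X : nd_braided_set.

Inductive A_rel : gterm X -> gterm X -> Prop :=
  | A_Rel x y :
      A_rel (GMul (GGen (phi y x)) (GGen x)) (GMul (GGen x) (GGen y)).

Definition A_ := gpres A_rel.
HB.instance Definition _ := Group.on A_.

Definition psi_A (x : X) : A_ := gpres_gen A_rel x.

Definition phi_permut (x : X) : permut X := Permut (phi_bij x).

(* gpres_lift evaluates a representing term; it is a homomorphism (A_actM) with
   psi_A x acting by y |-> phi y x (A_act_psi) because phi_permut satisfies the
   relations of A_X (A_rel_act). *)
Definition A_act (a : A_) : permut X := gpres_lift phi_permut a.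

Lemma A_rel_act u v :
  A_rel u v -> geval phi_permut u = geval phi_permut v.
Proof. by case=> x y; apply: permutP => z; exact/esym/phi_phi. Qed.

Lemma A_act_psi x y : A_act (psi_A x) y = phi y x.
Proof. by rewrite /A_act (gpres_lift_gen A_rel_act). Qed.

Lemma A_actM : {morph A_act : a b / (a * b)%g}.
Proof. exact: gpres_liftM A_rel_act. Qed.

Lemma A_act1 : A_act 1%g = 1%g.
Proof. exact: gpres_lift1 A_rel_act. Qed.

Lemma A_actV : {morph A_act : a / (a^-1)%g}.
Proof. exact: gpres_liftV A_rel_act. Qed.

(* A_X^0, the image of A_X in permut X. *)
Definition A0_pred : {pred permut X} := fun s => `[< exists a, A_act a = s >].

Lemma A0_predP s : s \in A0_pred <-> exists a, A_act a = s.
Proof. by split=> [/asboolP|?] //; apply/asboolP. Qed.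

Lemma A0_group_closed : group_closed A0_pred.
Proof.
split=> [|_ _ /A0_predP[a <-] /A0_predP[b <-]]; apply/A0_predP.
  by exists 1%g; exact: A_act1.
by exists (a / b)%g; rewrite A_actM A_actV.
Qed.

Record A0 := MkA0 { A0_val : permut X; A0_valP : A0_val \in A0_pred }.

HB.instance Definition _ := [isSub for A0_val].
HB.instance Definition _ := [Choice of A0 by <:].
HB.instance Definition _ :=
  SubChoice_isSubGroup.Build (permut X) A0_pred A0 A0_group_closed.

Lemma A_act_A0 a : A_act a \in A0_pred.
Proof. by apply/A0_predP; exists a. Qed.

Definition p : A_ -> A0 := locked (fun a => MkA0 (A_act_A0 a)).

Lemma A0_val_p a : A0_val (p a) = A_act a.
Proof. by rewrite /p -lock. Qed.

Local Notation ZA0 := (group_ring A0).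

Definition free_v : X -> {malg ZA0[X]} := locked (fun x => << x >>).

Lemma free_vE x : free_v x = << x >>.
Proof. by rewrite /free_v -lock. Qed.

(* The relators, in the free module {malg ZA0[X]} with basis free_v. *)
Inductive M_rel : {malg ZA0[X]} -> Prop :=
  | M_Rel x y : M_rel
      ((gr_of ((p (psi_A y))^-1)%g *: free_v x + free_v y)
       - (gr_of ((p (psi_A x))^-1)%g *: free_v (phi y x) + free_v x)).

Definition psi_M (x : X) : lmod_pres M_rel := lmod_pi M_rel (free_v x).

End DerivedStructureGroup.

Notation M_ X := (lmod_pres (@M_rel X)).

Lemma psi_M_rel (X : nd_braided_set) (x y : X) :
  gr_of ((p (psi_A y))^-1)%g *: psi_M x + psi_M y
    = gr_of ((p (psi_A x))^-1)%g *: psi_M (phi y x) + psi_M x :> M_ X.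
Proof. by apply: lmod_pi_rel; exact: M_Rel. Qed.

(* Main.v *)
From HB Require Import structures.
Require Import Defs.
From mathcomp Require Import all_boot.
From mathcomp Require Import all_algebra.
From mathcomp Require Import finmap monalg boolp.

Set Implicit Arguments.
Unset Strict Implicit.
Unset Printing Implicit Defensive.

Import GRing.Theory.

Local Open Scope group_scope.

(** Three groups act behind the scenes: the structure group G, the derived
    structure group A (the enveloping group of the rack with operation phi),
    and the affine group of M.  The theorem holds pointwise: two elements x, y
    of X have the same image in G iff they have the same image in A iff they
    have the same image in M.

    G versus A.  The maps [f_ y] give a right action of G on X by rack
    automorphisms, hence on A, and there is a bijective 1-cocycle
    pi : G -> A, pi (a b) = (pi a <| b) (pi b), which extends the identity of
    X.  The proof does not construct pi, but transports left multiplications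
    along it: each group acts on the underlying set of the other.  The element
    x of G acts on A as a |-> (psi_A x * a) <| x^-1 ([twist], [psi_G_psi_A]),
    and the element x of A acts on G as a |-> psi_G (x <| a^-1) * a ([shift],
    [psi_A_psi_G]).  In both cases the image of x in the group acted upon can be
    read off from the image of the unit.  The one delicate point is that
    [shift x] is invertible, which amounts to the bijectivity of the diagonal
    map u |-> star u u ([rho_diagK], [star_diagK]).

    A versus M.  The relators of M say that x |-> v_x extends to the universal
    1-cocycle on A with values in an A0-module, so psi_M factors through psi_A
    ([psi_A_psi_M], by affine transformations of M).  Conversely
    every cocycle on A factors through M ([psi_M_invariant]), and two cocycles
    together separate the elements of A.  The principal cocycle
    a |-> 1 - p(a)^-1 in Z[A0] detects p(a) ([psi_M_p]).  The kernel of p acts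
    trivially on X, hence is central in A ([ker_p_central]); it is therefore an
    abelian group, and a set-theoretic section of p gives the
    Kaloujnine-Krasner embedding of A into the wreath product of the kernel by
    A0, whose cocycle [transfer] determines a once p(a) is known
    ([psi_M_psi_A]). *)

(** * Groups given by generators and relations *)

Section Presentations.
Variable I : Type.
Variable r : gterm I -> gterm I -> Prop.

Lemma gpres_relM x y x' y' :
  r (GMul (GGen x) (GGen y)) (GMul (GGen x') (GGen y')) ->
  gpres_gen r x * gpres_gen r y = gpres_gen r x' * gpres_gen r y'.
Proof.
by move=> rxy; rewrite -[LHS]gpres_piM -[RHS]gpres_piM; apply/gpres_piP/GP_rel.
Qed.

Lemma gpres_gen_ind (P : gpres r -> Prop) :
  (forall i, P (gpres_gen r i)) -> P 1 ->
  (forall a b, P a -> P b -> P (a * b)) -> (forall a, P a -> P a^-1) ->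
  forall a, P a.
Proof.
move=> Pgen P1 PM PV; elim/gpres_ind; elim=> [i||u Pu v Pv|u Pu].
- exact: Pgen.
- exact: P1.
- by rewrite gpres_piM; exact: PM.
- by rewrite gpres_piV; exact: PV.
Qed.

End Presentations.

(** * Permutations and braidings *)

Lemma permutM T (s t : permut T) z : (s * t) z = s (t z).
Proof. by []. Qed.

Lemma braid_g T (R : T * T -> T * T) (RP : braid_relation R) x y z :
  g_ R x (g_ R y z) = g_ R (g_ R x y) (g_ R (f_ R y x) z).
Proof. by move: (RP (x, y, z)); rewrite /S1 /S2 !SE => -[]. Qed.

(** * Additive maps on free modules and their quotients *)

Section MalgLift.
Local Open Scope ring_scope.
Variables (K : choiceType) (V W : zmodType) (F : K -> V -> W).
Hypothesis FD : forall k, {morph F k : u v / u + v}.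

Let F0 k : F k 0 = 0.
Proof. by apply: (addrI (F k 0)); rewrite -FD !addr0. Qed.

Definition malg_lift (m : {malg V[K]}) : W := \sum_(k <- msupp m) F k m@_k.

Let malg_liftw (d : {fset K}) m : (msupp m `<=` d)%fset ->
  malg_lift m = \sum_(k <- d) F k m@_k.
Proof.
by move=> le; apply: big_fset_incl => // k _ /mcoeff_outdom ->; exact: F0.
Qed.

Lemma malg_liftD : {morph malg_lift : m n / m + n}.
Proof.
move=> m n; set d := (msupp m `|` msupp n)%fset.
rewrite (@malg_liftw d (m + n)) ?msuppD_le // (@malg_liftw d m) ?fsubsetUl //.
rewrite (@malg_liftw d n) ?fsubsetUr // -big_split /=; apply: eq_bigr => k _.
by rewrite mcoeffD FD.
Qed.

Lemma malg_liftU k v : malg_lift << v *g k >> = F k v.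
Proof. by rewrite (malg_liftw msuppU_le) big_seq_fset1 mcoeffUU. Qed.

End MalgLift.

Section MorphAdd.
Local Open Scope ring_scope.
Variables (U V : zmodType) (h : U -> V).
Hypothesis hD : {morph h : a b / a + b}.

Lemma morph_add0 : h 0 = 0.
Proof. by apply: (addrI (h 0)); rewrite -hD !addr0. Qed.

Lemma morph_addN : {morph h : a / - a}.
Proof. by move=> a; apply: (addrI (h a)); rewrite -hD !subrr morph_add0. Qed.

End MorphAdd.

Lemma malg_morph_eq0 (K : choiceType) (V W : zmodType) (h : {malg V[K]} -> W) :
  {morph h : m n / m + n >-> m + n}%R -> (forall k v, h << v *g k >> = 0)%R ->
  forall m, h m = 0%R.
Proof.
move=> hD hU m; rewrite (monalgE m) (big_morph h hD (morph_add0 hD)).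
by rewrite big1.
Qed.

Section LmodInvariant.
Local Open Scope ring_scope.
Variables (R : nzRingType) (V : lmodType R) (rels : V -> Prop) (W : zmodType).
Variable e : V -> W.
Hypothesis eD : {morph e : u v / u + v}.
Hypothesis e_rel : forall w, rels w -> forall a, e (a *: w) = 0.

(** The vectors all of whose multiples are killed by e form a submodule, even
    when e is merely additive. *)
Lemma lmod_pi_invariant u v : lmod_pi rels u = lmod_pi rels v ->
  forall a, e (a *: u) = e (a *: v).
Proof.
move=> /lmod_piP/span_relsP uv a.
pose N : {pred V} := fun m => `[< forall a, e (a *: m) = 0 >].
have /asboolP/(_ a) : u - v \in N.
  apply: uv => [|w rw]; last by apply/asboolP; exact: e_rel.
  split=> [|b w z /asboolP wN /asboolP zN]; apply/asboolP => d.
    by rewrite scaler0 (morph_add0 eD).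
  by rewrite scalerDr eD scalerA wN zN addr0.
by rewrite scalerBr eD (morph_addN eD) => /subr0_eq.
Qed.

Lemma morph_relator a b b' u v u' v' :
  e (a *: (b *: u + v - (b' *: u' + v'))) =
  e ((a * b) *: u) + e (a *: v) - (e ((a * b') *: u') + e (a *: v')).
Proof. by rewrite scalerBr !scalerDr !scalerA eD (morph_addN eD) !eD. Qed.

End LmodInvariant.

Lemma subrACA4 (W : zmodType) (a b c d a' b' c' d' : W) :
  (a + a' + (b + b') - (c + c' + (d + d')) =
   (a + b - (c + d)) + (a' + b' - (c' + d')))%R.
Proof.
by rewrite (addrACA a) (addrACA c) (opprD (c + d)%R); exact: addrACA.
Qed.

Lemma gr_mulU_of (H : groupType) (n : int) (s t : H) :
  ((<< n *g s >> : group_ring H) * gr_of t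
   = << n *g (s * t)%g >> :> group_ring H)%R.
Proof. by rewrite gr_ofE [LHS]gr_mulUU mulr1. Qed.

(** * The structure group acting on the solution *)

Section Solution.
Variable X : nd_braided_set.
Local Notation S := (@braiding X).
Local Notation S' := (@braiding_inv X).
Local Notation g := (g_ S).
Local Notation f := (f_ S).
Local Notation G := (G_ X).
Local Notation A := (A_ X).
Local Notation psiG := (@psi_G X).
Local Notation psiA := (@psi_A X).

Lemma psi_GM x y : psiG x * psiG y = psiG (g x y) * psiG (f y x).
Proof. by apply: gpres_relM; constructor; exact: SE. Qed.

Lemma psi_AM x y : psiA (phi y x) * psiA x = psiA x * psiA y.
Proof. by apply: gpres_relM; constructor. Qed.

Section Lifts.
Variables (H : groupType) (h : X -> H).

(** A map from X to a group that satisfies the relations of G (resp. A)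
    identifies whatever psi_G (resp. psi_A) identifies.  The groups H of interest
    are permutation groups: of X, of the other group, of M. *)
Lemma G_rel_lift :
  (forall x y : X, h x * h y = h (g x y) * h (f y x)) ->
  forall u v, G_rel u v -> geval h u = geval h v.
Proof. by move=> hM _ _ [x y y1 x1]; rewrite SE => -[<- <-] /=. Qed.

Lemma A_rel_lift :
  (forall x y : X, h (phi y x) * h x = h x * h y) ->
  forall u v, A_rel u v -> geval h u = geval h v.
Proof. by move=> hM _ _ [x y] /=. Qed.

Lemma psi_G_eq_lift x y :
  (forall x y : X, h x * h y = h (g x y) * h (f y x)) ->
  psiG x = psiG y -> h x = h y.
Proof.
move=> /G_rel_lift hr xy.
by rewrite -(gpres_lift_gen hr x) -(gpres_lift_gen hr y); congr gpres_lift.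
Qed.

Lemma psi_A_eq_lift x y :
  (forall x y : X, h (phi y x) * h x = h x * h y) ->
  psiA x = psiA y -> h x = h y.
Proof.
move=> /A_rel_lift hr xy.
by rewrite -(gpres_lift_gen hr x) -(gpres_lift_gen hr y); congr gpres_lift.
Qed.

End Lifts.

Lemma starK (y : X) : cancel (f y) (star y). Proof. exact: bij_invK. Qed.
Lemma starVK (y : X) : cancel (star y) (f y). Proof. exact: bij_invVK. Qed.

Definition star_permut (x : X) : permut X := Permut (bij_inv_bij (f_bij x)).

Lemma star_permutM x y :
  star_permut x * star_permut y = star_permut (g x y) * star_permut (f y x).
Proof.
apply: permutP => z; rewrite !permutM /=.
apply: (can_inj (starK (g x y))); apply: (can_inj (starK (f y x))).
by rewrite !starVK -(braid_f (@braidingP X)) !starVK.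
Qed.

Definition G_act (a : G) : permut X := gpres_lift star_permut a.

Lemma G_act_psi x z : G_act (psiG x) z = star x z.
Proof. by rewrite /G_act (gpres_lift_gen (G_rel_lift star_permutM)). Qed.

Lemma G_actM a b z : G_act (a * b) z = G_act a (G_act b z).
Proof. by rewrite /G_act (gpres_liftM (G_rel_lift star_permutM)). Qed.

Lemma G_act1 z : G_act 1 z = z.
Proof. by rewrite /G_act (gpres_lift1 (G_rel_lift star_permutM)). Qed.

Lemma G_actK a : cancel (G_act a) (G_act a^-1).
Proof. by move=> z; rewrite -G_actM mulVg G_act1. Qed.

Lemma G_actVK a : cancel (G_act a^-1) (G_act a).
Proof. by move=> z; rewrite -G_actM mulgV G_act1. Qed.

Lemma psi_G_star x y z : psiG x = psiG y -> star x z = star y z.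
Proof. by move=> xy; rewrite -!G_act_psi xy. Qed.

Lemma star_phi (z y x : X) : star z (phi y x) = phi (star z y) (star z x).
Proof. by apply: (can_inj (starK z)); rewrite f_phi !starVK. Qed.

Lemma g_bij x : bijective (g x).
Proof. exact: (braiding_nondegenerate X).1. Qed.

(** * Invertibility of the diagonal *)

Definition gdiv (x v : X) : X := bij_inv (g_bij x) v.

(** The action of v on the formal inverse of x: in G, the braiding sends
    (x^-1, v) to (gdiv x v, (rho v x)^-1).  The inverse permutation is
    [g_ S' v], for the inverse braiding S', and v |-> [g_ S' v] extends to an
    action of G. *)
Definition rho (v x : X) : X := f (gdiv x v) x.

Lemma braiding_rho v x : S (x, gdiv x v) = (v, rho v x).
Proof. by rewrite SE /gdiv bij_invVK. Qed.

Lemma rhoK v : cancel (rho v) (g_ S' v).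
Proof. by move=> x; rewrite /g_ -braiding_rho braidingK. Qed.

Lemma rhoVK v : cancel (g_ S' v) (rho v).
Proof.
move=> z; have := braiding_invK (v, z); rewrite (SE S' v z) (SE S) => -[gv fz].
by rewrite /rho /gdiv -[X in bij_inv _ X]gv bij_invK.
Qed.

Definition g'_permut (v : X) : permut X :=
  Permut (Bijective (@rhoVK v) (@rhoK v)).

Lemma g'_permutM x y :
  g'_permut x * g'_permut y = g'_permut (g x y) * g'_permut (f y x).
Proof.
apply: permutP => z; rewrite !permutM /=.
have := braidingK (x, y); rewrite (SE S) (SE S') => -[gx fy].
by rewrite [RHS](braid_g (@braid_inv X)) gx fy.
Qed.

Lemma psi_G_rho x y z : psiG x = psiG y -> rho x z = rho y z.
Proof.
move=> /(psi_G_eq_lift g'_permutM) xy.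
have gE t : g_ S' x t = g_ S' y t by rewrite -[LHS]/(g'_permut x t) xy.
by apply: (can_inj (@rhoVK x)); rewrite rhoK gE rhoK.
Qed.

(** If w = star u u, the braiding maps (w, u) to (y, u) for some y; cancelling u
    in G shows that w and y have the same image there, hence act alike through
    rho, so that u can be recovered from w alone. *)
Lemma rho_diagK : cancel (fun u => @star X u u) (fun w => rho w w).
Proof.
move=> u; set w := star u u.
have wu : S (w, u) = (tau u u, u) := braiding_tau u u.
have E : psiG w = psiG (tau u u).
  by have := psi_GM w u; rewrite starVK => /mulIg.
rewrite (psi_G_rho w E) -[X in rho _ X](_ : g_ S' (tau u u) u = w) ?rhoVK //.
by rewrite /g_ -wu braidingK.
Qed.

(** Here the braiding maps (w, u0) to (w, u1), and w is cancelled instead. *)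
Lemma star_diagK : cancel (fun w => rho w w) (fun u => @star X u u).
Proof.
move=> w; set u0 := gdiv w w; set u1 := rho w w.
have wu : S (w, u0) = (w, u1) := braiding_rho w w.
have E : psiG u0 = psiG u1.
  by have := psi_GM w u0; rewrite [g w u0]bij_invVK => /mulgI.
by rewrite -(psi_G_star _ E) /u1 /rho -/u0 starK.
Qed.

(** * Elements of X identified in G and in A *)

(** Left multiplication by psi_A x, transported from A to G along the inverse of
    the bijective cocycle G -> A. *)
Definition shift (x : X) (a : G) : G := psiG (G_act a x) * a.

(** If b = shift x a and u = G_act a x, then G_act b x = star u u, so u, and
    with it a, is recovered by inverting the diagonal map. *)
Definition unshift (x : X) (b : G) : G :=
  let w := G_act b x in (psiG (rho w w))^-1 * b.

Lemma shiftK x : cancel (shift x) (unshift x).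
Proof.
move=> a; rewrite /unshift /shift G_actM G_act_psi (rho_diagK (G_act a x)).
by rewrite mulKg.
Qed.

Lemma unshiftK x : cancel (unshift x) (shift x).
Proof.
move=> b; rewrite /unshift /shift; set w := G_act b x; set u := rho w w.
suff -> : G_act ((psiG u)^-1 * b) x = u by rewrite mulVKg.
rewrite G_actM -/w -[w in LHS](star_diagK w) -/u -G_act_psi.
exact: G_actK.
Qed.

Definition shift_permut x : permut G :=
  Permut (Bijective (@shiftK x) (@unshiftK x)).

Lemma G_act_phi a (y x : X) : G_act a (phi y x) = phi (G_act a y) (G_act a x).
Proof.
elim/gpres_gen_ind: a x y => [i||a b IHa IHb|a IHa] x y.
- by rewrite !G_act_psi star_phi.
- by rewrite !G_act1.
- by rewrite !G_actM IHb IHa.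
- by apply: (can_inj (G_actK a)); rewrite IHa !G_actVK.
Qed.

Lemma shift_permutM x y :
  shift_permut (phi y x) * shift_permut x = shift_permut x * shift_permut y.
Proof.
apply: permutP => a; rewrite !permutM /= /shift !G_actM !G_act_psi G_act_phi.
move: (G_act a x) (G_act a y) => {}x {}y; rewrite !mulgA; congr (_ * _).
rewrite [RHS]psi_GM starVK.
by congr (psiG _ * _); apply: (can_inj (starVK x)); rewrite starK.
Qed.

Lemma psi_A_psi_G x y : psiA x = psiA y -> psiG x = psiG y.
Proof.
move=> /(psi_A_eq_lift shift_permutM)/(congr1 (fun s : permut G => s 1)) /=.
by rewrite /shift !G_act1 !mulg1.
Qed.

Section Functoriality.
Variable s : X -> X.
Hypothesis s_phi : forall y x : X, s (phi y x) = phi (s y) (s x).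

Definition A_map (a : A) : A := gpres_lift (psiA \o s) a.

Let hr := A_rel_lift (h := psiA \o s)
  (fun x y => etrans (congr1 (fun z => psiA z * _) (s_phi y x)) (psi_AM _ _)).

Lemma A_map_psi x : A_map (psiA x) = psiA (s x).
Proof. exact: gpres_lift_gen hr x. Qed.
Lemma A_mapM : {morph A_map : a b / a * b}.
Proof. exact: gpres_liftM hr. Qed.
Lemma A_map1 : A_map 1 = 1.
Proof. exact: gpres_lift1 hr. Qed.
Lemma A_mapV : {morph A_map : a / a^-1}.
Proof. exact: gpres_liftV hr. Qed.
End Functoriality.

Lemma A_map_comp s t (s_phi : forall y x : X, s (phi y x) = phi (s y) (s x))
    (t_phi : forall y x : X, t (phi y x) = phi (t y) (t x)) (a : A) :
  A_map s (A_map t a) = A_map (s \o t) a.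
Proof.
have st_phi (y x : X) : (s \o t) (phi y x) = phi ((s \o t) y) ((s \o t) x).
  by rewrite /= t_phi s_phi.
elim/gpres_gen_ind: a => [x||a b IHa IHb|a IHa].
- by rewrite !A_map_psi.
- by rewrite !A_map1.
- by rewrite !A_mapM ?IHa ?IHb.
- by rewrite !A_mapV ?IHa.
Qed.

Lemma A_map_id s (a : A) : s =1 id -> A_map s a = a.
Proof.
move=> s1; have s_phi (y x : X) : s (phi y x) = phi (s y) (s x) by rewrite !s1.
elim/gpres_gen_ind: a => [x||a b IHa IHb|a IHa].
- by rewrite A_map_psi ?s1.
- by rewrite A_map1.
- by rewrite A_mapM ?IHa ?IHb.
- by rewrite A_mapV ?IHa.
Qed.

(** Left multiplication by psi_G x, transported from G to A along
    b |-> (pi (b^-1))^-1, where pi is the bijective cocycle. *)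
Definition twist (x : X) (a : A) : A := A_map (star x) (psiA x * a).
Definition untwist (x : X) (b : A) : A := (psiA x)^-1 * A_map (f x) b.

Lemma twistK x : cancel (twist x) (untwist x).
Proof.
move=> a; rewrite /untwist /twist A_map_comp; last exact: star_phi.
  by rewrite A_map_id ?mulKg //; exact: starVK.
exact: f_phi.
Qed.

Lemma untwistK x : cancel (untwist x) (twist x).
Proof.
move=> b; rewrite /untwist /twist mulVKg A_map_comp; last exact: f_phi.
  by rewrite A_map_id //; exact: starK.
exact: star_phi.
Qed.

Definition twist_permut x : permut A :=
  Permut (Bijective (@twistK x) (@untwistK x)).

Lemma twist_permutM x y :
  twist_permut x * twist_permut y = twist_permut (g x y) * twist_permut (f y x).
Proof.
apply: permutP => a; rewrite !permutM /= /twist.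
have sp := star_phi; rewrite !A_mapM //; try exact: sp.
rewrite !A_map_comp //; try exact: sp.
have lE (z : X) :
    star x (star y z) = star (g x y) (star (f y x) z).
  by rewrite -[LHS]/((star_permut x * star_permut y) z) star_permutM.
have -> : star (g x y) \o star (f y x) = star x \o star y.
  by apply/funext => z /=; rewrite lE.
have mp (v u : X) : (star x \o star y) (phi v u)
    = phi ((star x \o star y) v) ((star x \o star y) u) by rewrite /= !star_phi.
rewrite !mulgA; congr (_ * _).
rewrite !A_map_psi //.
have -> : star x x = star x (star y (f y x)) by rewrite starK.
have -> : star (g x y) (g x y) = star x (star y (phi y (f y x))).
  by rewrite phi_f lE /phi_aux starK.
by rewrite /= !star_phi psi_AM.
Qed.

Lemma psi_G_psi_A x y : psiG x = psiG y -> psiA x = psiA y.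
Proof.
move=> xy; have := psi_G_eq_lift twist_permutM xy.
move=> /(congr1 (fun s : permut A => s 1)) /=.
rewrite /twist !mulg1 !A_map_psi; try exact: star_phi.
rewrite (psi_G_star y (esym xy)) => /(congr1 (A_map (f x))).
by rewrite !A_map_psi ?starVK //; exact: f_phi.
Qed.

(** * Invariants of the module M *)

Section ModuleInvariants.
Local Open Scope ring_scope.
Local Notation A0 := (A0 X).
Local Notation ZA0 := (group_ring A0).
Variables (W : zmodType) (c : X -> A0 -> W).

(** Here e extends, additively, h v_x |-> c x h to the free module on the v_x,
    and l x is its restriction to the multiples of v_x. *)
Lemma coord_extension : exists (e : {malg ZA0[X]} -> W) (l : X -> ZA0 -> W),
  [/\ {morph e : u v / u + v},
      forall x, {morph l x : a b / a + b},
      forall a x, e (a *: free_v x) = l x a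
    & forall x h (n : int), l x << n *g h >> = c x h *~ n].
Proof.
pose l x : ZA0 -> W := malg_lift (fun h (n : int) => c x h *~ n).
have lD x : {morph l x : a b / a + b}.
  by apply: malg_liftD => h m n; exact: mulrzDr.
exists (malg_lift l), l; split => //.
- exact: malg_liftD.
- move=> a x; rewrite free_vE (_ : a *: _ = << a *g x >>).
    exact: malg_liftU.
  by apply/malgP => k; rewrite mcoeffZ !mcoeffU mulrnAr mulr1.
- move=> x h n; apply: malg_liftU => k a b; exact: mulrzDr.
Qed.

(** This is the cocycle condition, for c x seen as an element of the coinduced
    module of functions A0 -> W, on which t acts by (t F) h = F (h * t). *)
Hypothesis c_rel : forall x y h,
  c x (h * (p (psi_A y))^-1)%g + c y h =
  c (phi y x) (h * (p (psi_A x))^-1)%g + c x h.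

(** By adjunction, a linear map from M to the coinduced module is the same as an
    additive map from M to W, namely its value at 1. *)
Lemma psi_M_invariant x y : psi_M x = psi_M y -> c x =1 c y.
Proof.
have [e [l [eD lD eZ lU]]] := coord_extension.
move=> xy h; have : e (gr_of h *: free_v x) = e (gr_of h *: free_v y).
  apply: (lmod_pi_invariant eD _ xy) => _ [{xy}x {}y] a.
  rewrite morph_relator // !eZ.
  set py := gr_of _; set px := gr_of _.
  pose r (b : ZA0) := l x (b * py) + l y b - (l (phi y x) (b * px) + l x b).
  rewrite -/(r a); apply: (@malg_morph_eq0 A0 int W r) => [b1 b2|k n].
    by rewrite /r !mulrDl !lD subrACA4.
  by rewrite /r !gr_mulU_of !lU -!mulrzDl c_rel subrr.
by rewrite !eZ gr_ofE !lU !mulr1z.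
Qed.

End ModuleInvariants.

(** * Elements of X identified in A and in M *)

Section Faithfulness.

Lemma pM : {morph @p X : a b / a * b}.
Proof.
by move=> a b; apply: val_inj; rewrite [LHS]A0_val_p A_actM -!A0_val_p.
Qed.

Lemma p1 : p (1 : A) = 1.
Proof. by apply: (mulIg (p (1 : A))); rewrite -pM !mul1g. Qed.

Lemma pV : {morph @p X : a / a^-1}.
Proof. by move=> a; apply/esym/mulg1_eq; rewrite -pM mulgV p1. Qed.

Lemma p_act (a b : A) : p a = p b -> A_act a = A_act b.
Proof. by move=> ab; rewrite -!A0_val_p ab. Qed.

(** Conjugation in A realizes the action of A on X, so an element acting
    trivially is central. *)
Lemma psi_A_conj (a : A) (x : X) : a * psiA x = psiA (A_act a x) * a.
Proof.
elim/gpres_gen_ind: a x => [y||a b IHa IHb|a IHa] x.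
- by rewrite A_act_psi psi_AM.
- by rewrite A_act1 mul1g mulg1.
- by rewrite A_actM -mulgA IHb mulgA IHa -mulgA.
- apply: (mulgI a); apply: (mulIg a); rewrite !mulgA mulgV mul1g mulgVK.
  rewrite IHa -permutM -A_actM mulgV A_act1; congr (_ * _); exact: mulgK.
Qed.

Lemma ker_p_central (k b : A) : p k = 1 -> k * b = b * k.
Proof.
rewrite -p1 => /p_act; rewrite A_act1 => k1.
elim/gpres_gen_ind: b => [x||a b IHa IHb|a IHa].
- by rewrite psi_A_conj k1.
- by rewrite mul1g mulg1.
- by rewrite mulgA IHa -mulgA IHb mulgA.
- apply: (mulgI a); apply: (mulIg a).
  by rewrite !mulgA -IHa mulgV mul1g !mulgVK.
Qed.

Definition ker_p : Type := {a : A | p a == 1}.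
HB.instance Definition _ := Choice.on ker_p.
HB.instance Definition _ := SubType.on ker_p.

Lemma ker_p_val (k : ker_p) : p (val k) = 1.
Proof. by case: k => k /= /eqP. Qed.

Definition in_ker (a : A) (pa : p a = 1) : ker_p := exist _ a (introT eqP pa).

Lemma ker_pM_subproof (k l : ker_p) : p (val k * val l) = 1.
Proof. by rewrite pM !ker_p_val mulg1. Qed.
Lemma ker_pV_subproof (k : ker_p) : p (val k)^-1 = 1.
Proof. by rewrite pV ker_p_val invg1. Qed.

Definition ker_pM (k l : ker_p) : ker_p := in_ker (ker_pM_subproof k l).
Definition ker_pV (k : ker_p) : ker_p := in_ker (ker_pV_subproof k).
Definition ker_p1 : ker_p := in_ker p1.

Lemma ker_pA : associative ker_pM.
Proof. by move=> k l m; apply: val_inj => /=; rewrite mulgA. Qed.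
Lemma ker_pC : commutative ker_pM.
Proof. by move=> k l; apply: val_inj; exact/ker_p_central/ker_p_val. Qed.
Lemma ker_p1M : left_id ker_p1 ker_pM.
Proof. by move=> k; apply: val_inj => /=; rewrite mul1g. Qed.
Lemma ker_pVM : left_inverse ker_p1 ker_pV ker_pM.
Proof. by move=> k; apply: val_inj => /=; rewrite mulVg. Qed.

HB.instance Definition _ :=
  GRing.isZmodule.Build ker_p ker_pA ker_pC ker_p1M ker_pVM.

Lemma ker_p_valD (k l : ker_p) : val (k + l)%R = val k * val l.
Proof. by []. Qed.

Lemma p_surj (h : A0 X) : exists a : A, p a = h.
Proof.
have /A0_predP[a ah] := A0_valP h.
by exists a; apply: val_inj; rewrite [LHS]A0_val_p.
Qed.

Definition p_section (h : A0 X) : A := projT1 (cid (p_surj h)).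

Lemma p_sectionK h : p (p_section h) = h.
Proof. by rewrite /p_section; case: cid. Qed.

Lemma transfer_subproof (x : X) (h : A0 X) :
  p (p_section (h * (p (psiA x))^-1) * psiA x * (p_section h)^-1) = 1.
Proof. by rewrite !pM pV !p_sectionK mulgVK mulgV. Qed.

(** The Kaloujnine-Krasner cocycle attached to the section. *)
Definition transfer (x : X) (h : A0 X) : ker_p :=
  in_ker (transfer_subproof x h).

Lemma transfer_rel x y h :
  (transfer x (h * (p (psiA y))^-1)%g + transfer y h =
   transfer (phi y x) (h * (p (psiA x))^-1)%g + transfer x h)%R.
Proof.
apply: val_inj; rewrite !ker_p_valD /=; rewrite !mulgA !mulgVK.
rewrite -[_ * psiA x * psiA y]mulgA -psi_AM mulgA.
congr (p_section _ * _ * _ * _).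
by rewrite -!mulgA -!invgM -!pM psi_AM.
Qed.

(** This is h * (1 - p(x)^-1): the principal cocycle a |-> 1 - p(a)^-1, with the
    function of h standing for left multiplication by h in the group ring. *)
Definition boundary (x : X) (h : A0 X) : {malg int[A0 X]} :=
  (<< h >> - << (h * (p (psiA x))^-1)%g >>)%R.

Lemma boundary_rel x y h :
  (boundary x (h * (p (psiA y))^-1)%g + boundary y h =
   boundary (phi y x) (h * (p (psiA x))^-1)%g + boundary x h)%R.
Proof.
rewrite /boundary -!mulgA -!invgM -!pM psi_AM.
by rewrite addrC addrA subrK [RHS]addrC addrA subrK.
Qed.

Lemma psi_M_p x y : psi_M x = psi_M y -> p (psiA x) = p (psiA y).
Proof.
move/(psi_M_invariant boundary_rel)/(_ 1)/addrI/oppr_inj.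
rewrite !mul1g => /(congr1 (mcoeff (p (psiA x))^-1)).
by rewrite mcoeffUU mcoeffU; case: eqP => [/invg_inj|].
Qed.

Lemma psi_M_psi_A x y : psi_M x = psi_M y -> psiA x = psiA y.
Proof.
move=> xy; have := psi_M_invariant transfer_rel xy 1 => /(congr1 val) /=.
by rewrite (psi_M_p xy) => /mulIg/mulgI.
Qed.

End Faithfulness.

Section Affine.
Local Notation M := (lmod_pres (@M_rel X)).
Local Open Scope ring_scope.

Lemma gr_ofK (a : A) (m : M) : gr_of (p a)^-1%g *: (gr_of (p a) *: m) = m.
Proof. by rewrite scalerA -gr_ofM mulVg scale1r. Qed.
Lemma gr_ofVK (a : A) (m : M) : gr_of (p a) *: (gr_of (p a)^-1%g *: m) = m.
Proof. by rewrite scalerA -gr_ofM mulgV scale1r. Qed.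

(** With c the universal cocycle, a acts on M by m |-> p(a) (m + c(a)). *)
Definition affine (x : X) (m : M) : M := gr_of (p (psiA x)) *: (m + psi_M x).
Definition unaffine (x : X) (m : M) : M :=
  gr_of (p (psiA x))^-1%g *: m - psi_M x.

Lemma affineK x : cancel (affine x) (unaffine x).
Proof. by move=> m; rewrite /unaffine /affine gr_ofK addrK. Qed.
Lemma unaffineK x : cancel (unaffine x) (affine x).
Proof. by move=> m; rewrite /unaffine /affine subrK gr_ofVK. Qed.

Definition affine_permut x : permut M :=
  Permut (Bijective (@affineK x) (@unaffineK x)).

Lemma affine_permutM x y :
  (affine_permut (phi y x) * affine_permut x =
   affine_permut x * affine_permut y)%g.
Proof.
apply: permutP => m; rewrite !permutM /= /affine.
have E z w :
  gr_of (p (psiA z)) *: (gr_of (p (psiA w)) *: (m + psi_M w) + psi_M z)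
  = gr_of (p (psiA z * psiA w)%g) *:
      (m + (gr_of (p (psiA w))^-1%g *: psi_M z + psi_M w)).
  rewrite pM gr_ofM -scalerA; congr (_ *: _).
  by rewrite !scalerDr gr_ofVK -addrA; congr (_ + _); rewrite addrC.
by rewrite !E psi_AM (psi_M_rel x y).
Qed.

Lemma psi_A_psi_M x y : psiA x = psiA y -> psi_M x = psi_M y.
Proof.
move=> xy; have := psi_A_eq_lift affine_permutM xy.
move=> /(congr1 (fun s : permut M => s 0)) /=.
rewrite /affine !add0r -xy => /(congr1 (fun m => gr_of (p (psiA x))^-1%g *: m)).
by rewrite !gr_ofK.
Qed.

End Affine.

End Solution.

Theorem corollary1 (X : nd_braided_set) :
  injective (@psi_M X) <-> injective_solution X.
Proof.
split=> inj x y.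
  by move=> /psi_G_psi_A/psi_A_psi_M/inj.
by move=> /psi_M_psi_A/psi_A_psi_G/inj.
Qed.
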